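(* Let $X$ be a real Banach space, $u,f_j,g_i\colon X\to\mathbb{R}$, $j\in J=\{1,\dots,l\}$, $i\in I=\{1,\dots,m\}$, and consider the problem $$(\mathcal{P})\qquad \min\ u(x)\quad\text{subject to } f_j(x)=0,\ j\in J,\quad g_i(x)\le0,\ i\in I.$$ Let $u$, $f_j$, $j\in J$, and $g_i$, $i\in I$, be quasidifferentiable at a feasible point $\overline{x}$ of $(\mathcal{P})$, and let $\Psi_c(x)=u(x)+c\big(\sum_{j=1}^l|f_j(x)|+\sum_{i=1}^m\max\{g_i(x),0\}\big)$. Then for $c\ge0$ the following two conditions are equivalent: (A) $\mathbb{O}\in\underline{\partial}\Psi_c(\overline{x})+w^*$ for all $w^*\in\overline{\partial}\Psi_c(\overline{x})$, where $[\underline{\partial}\Psi_c(\overline{x}),\overline{\partial}\Psi_c(\overline{x})]$ is a quasidifferential of $\Psi_c$ at $\overline{x}$; (B) for any $w_0^*\in\overline{\partial}u(\overline{x})$, $v_j^*\in\underline{\partial}f_j(\overline{x})$, $w_j^*\in\overline{\partial}f_j(\overline{x})$, $j\in J$, and $z_i^*\in\overline{\partial}g_i(\overline{x})$, $i\in I$, there exist $\underline{\mu}_j,\overline{\mu}_j,\lambda_i\ge0$ such that $$\mathbb{O}\in\underline{\partial}u(\overline{x})+w_0^*-\sum_{j=1}^l\underline{\mu}_j\big(v_j^*+\overline{\partial}f_j(\overline{x})\big)+\sum_{j=1}^l\overline{\mu}_j\big(\underline{\partial}f_j(\overline{x})+w_j^*\big)+\sum_{i=1}^m\lambda_i\big(\underline{\partial}g_i(\overline{x})+z_i^*\big),$$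 and for all $i\in I$ and $j\in J$ one has $\lambda_ig_i(\overline{x})=0$ and $\max\{\underline{\mu}_j+\overline{\mu}_j,\lambda_i\}\le c$. Furthermore, both these conditions are independent of the choice of the corresponding quasidifferentials: if (A) holds for one quasidifferential of $\Psi_c$ at $\overline{x}$, then it holds for every quasidifferential of $\Psi_c$ at $\overline{x}$; and if (B) holds for one choice of quasidifferentials of $u$, $f_j$, $g_i$ at $\overline{x}$, then it holds for every choice of quasidifferentials of these functions at $\overline{x}$.
   Context: $X^*$ is the topological dual of $X$, $\mathbb{O}$ is the zero vector, sums of sets are Minkowski sums. A real-valued function $f$ defined on an open subset of $X$ is quasidifferentiable at $x$ if for all $h\in X$ the finite limit $f'(x,h)=\lim_{\alpha\to+0}(f(x+\alpha h)-f(x))/\alpha$ exists and there is a pair $[\underline{\partial}f(x),\overline{\partial}f(x)]$ (called a quasidifferential of $f$ at $x$; it is not unique) of (nonempty) convex weak$^*$ compact subsets of $X^*$ with $$f'(x,h)=\max_{v^*\in\underline{\partial}f(x)}\langle v^*,h\rangle+\min_{w^*\in\overline{\partial}f(x)}\langle w^*,h\rangle\quad\forall h\in X.$$ Whenever a function $f$ is said to be quasidifferentiable at a point $x$, a quasidifferential of $f$ at $x$ is assumed given; it is denoted by $[\underline{\partial}f(x),\overline{\partial}f(x)]$. If $u,f_j,g_i$ are quasidifferentiable at $\overline{x}$, then so is $\Psi_c$. A point is feasible for $(\mathcal{P})$ if it satisfies all its constraints. *)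

(* Defs.v *)
From HB Require Import structures.
From mathcomp Require Import all_boot all_order all_algebra.
From mathcomp Require Import all_classical all_reals all_analysis.
Import Order.TTheory GRing.Theory Num.Theory.
Import numFieldNormedType.Exports.

Set Implicit Arguments.
Unset Strict Implicit.
Unset Printing Implicit Defensive.

Local Open Scope classical_set_scope.
Local Open Scope ring_scope.

Reserved Notation "A `+s` B" (at level 50, left associativity).
Reserved Notation "t `*:` A" (at level 40, left associativity).
Reserved Notation "\msum_ ( i < n ) F"
  (at level 36, i at level 50, n at level 50, F at level 36,
   format "'[' \msum_ ( i  <  n ) '/  '  F ']'").

Definition minkowski_sum (V : zmodType) (A B : set V) : set V :=
  [set a + b | a in A & b in B].

Definition scale_set (R : pzRingType) (V : lmodType R) (t : R) (A : set V) :
  set V := [set t *: a | a in A].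

Notation "A `+s` B" := (minkowski_sum A B) : classical_set_scope.
Notation "t `*:` A" := (scale_set t A) : classical_set_scope.
Notation "\msum_ ( i < n ) F" :=
  (\big[@minkowski_sum _/[set 0]]_(i < n) F) : classical_set_scope.

Section Quasidifferential.
Variables (R : realType) (X : normedModType R).

Definition dual : set (X -> R^o) := [set v | linear v /\ continuous v].

(* The weak* topology is the one induced on the dual by pointwise convergence;
   since A lies in the dual, compactness may be tested in {ptws X -> R^o}. *)
Definition convex_weak_star_compact (A : set (X -> R^o)) : Prop :=
  [/\ A `<=` dual, A !=set0, convex_set A & compact (A : set {ptws X -> R^o})].

Definition is_max (S : set R) (M : R) : Prop := S M /\ ubound S M.

Definition is_min (S : set R) (m : R) : Prop := S m /\ lbound S m.

Definition has_dir_derivative (f : X -> R) (x h : X) (d : R) : Prop :=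
  (f (x + a *: h) - f x) / a @[a --> 0^'+] --> d.

(* In a pair D, D.1 is the subdifferential and D.2 the superdifferential. *)
Definition is_quasidifferential (f : X -> R) (x : X)
    (D : set (X -> R^o) * set (X -> R^o)) : Prop :=
  [/\ convex_weak_star_compact D.1, convex_weak_star_compact D.2 &
      forall h : X, exists M m : R,
        [/\ is_max [set v h | v in D.1] M, is_min [set w h | w in D.2] m &
            has_dir_derivative f x h (M + m)]].

Definition quasidifferentiable (f : X -> R) (x : X) : Prop :=
  exists D, is_quasidifferential f x D.

End Quasidifferential.

Section PenaltyProblem.
Variables (R : realType) (X : normedModType R) (l m : nat).
Variables (u : X -> R) (f : 'I_l -> X -> R) (g : 'I_m -> X -> R).

Definition feasible (x : X) : Prop :=
  (forall j, f j x = 0) /\ (forall i, g i x <= 0).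

Definition Psi (c : R) (x : X) : R :=
  u x + c * (\sum_(j < l) `|f j x| + \sum_(i < m) Num.max (g i x) 0).

Definition conditionA (D : set (X -> R^o) * set (X -> R^o)) : Prop :=
  forall w, D.2 w -> (D.1 `+s` [set w]) 0.

(* The bound max{mu_lo j + mu_up j, lam i} <= c for all i and j is split into one
   bound per index, so that it keeps its meaning when l = 0 or m = 0. *)
Definition conditionB (c : R) (x : X)
    (Du : set (X -> R^o) * set (X -> R^o))
    (Df : 'I_l -> set (X -> R^o) * set (X -> R^o))
    (Dg : 'I_m -> set (X -> R^o) * set (X -> R^o)) : Prop :=
  forall (w0 : X -> R^o) (v w : 'I_l -> X -> R^o) (z : 'I_m -> X -> R^o),
    Du.2 w0 ->
    (forall j, (Df j).1 (v j)) -> (forall j, (Df j).2 (w j)) ->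
    (forall i, (Dg i).2 (z i)) ->
  exists (mu_lo mu_up : 'I_l -> R) (lam : 'I_m -> R),
    [/\ (forall j, 0 <= mu_lo j /\ 0 <= mu_up j), (forall i, 0 <= lam i),
        (Du.1 `+s` [set w0]
         `+s` (-1) `*:` (\msum_(j < l) (mu_lo j `*:` ([set v j] `+s` (Df j).2)))
         `+s` (\msum_(j < l) (mu_up j `*:` ((Df j).1 `+s` [set w j])))
         `+s` (\msum_(i < m) (lam i `*:` ((Dg i).1 `+s` [set z i])))) 0,
        (forall i, lam i * g i x = 0) &
        (forall j, mu_lo j + mu_up j <= c) /\ (forall i, lam i <= c)].

End PenaltyProblem.

(* Main.v *)
Require Import Defs.
From HB Require Import structures.
From mathcomp Require Import all_boot all_order all_algebra.
From mathcomp Require Import all_classical all_reals all_analysis.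
From mathcomp Require Import ring lra.
Import Order.TTheory GRing.Theory Num.Theory.
Import numFieldNormedType.Exports.
Local Open Scope classical_set_scope.
Local Open Scope ring_scope.

(** Both conditions say the same thing, and it does not mention any
quasidifferential: every directional derivative of the penalty function
[Psi] at [x] is nonnegative ([dir_stationary]).  The equivalence of (A) and (B)
and the independence of the quasidifferentials follow at once from
[conditionAP] and [conditionBP].

Why (A) means that. The directional derivative in direction [h] is the minimum
over [w] of the values at [h] of the support functions of the sets [D.1 + w].
Hence it is nonnegative for all [h] if and only if every set [D.1 + w] has a
nonnegative support function, and for a convex weak* compact set this is the
same as containing [0].

Why (B) means that. Fix the selections [w0], [v], [w], [z].  When the
multipliers run through their admissible values, the right-hand side of the
inclusion in (B) runs through one convex weak* compact set, [multiplier_set].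
It is the Minkowski sum of [Du.1 + w0], of the sets
[c conv (0, Df.1 + w, -(v + Df.2))] and, for the active inequality constraints,
of the sets [c conv (0, Dg.1 + z)].  Its support function at [h] is the sum of
the support functions of these pieces, hence it is at least [Psi'(x, h)] for
all selections, with equality when the selections are those which attain the
extrema in the definition of a quasidifferential in direction [h]: then the
piece of an equality constraint gives
[c max (0, f'(x, h), -f'(x, h)) = c |f'(x, h)|],
and the piece of an active inequality constraint gives [c max (0, g'(x, h))].
Again, the set contains [0] if and only if its support function is nonnegative.

The separation statement [zero_in_convex_compact] has a short proof by
compactness in the topology of pointwise convergence.  By the finite
intersection property it is enough to find, for finitely many directions, an
element of the set that vanishes on them, and an element that minimises the sum
of the squares of its values on these directions does so. *)

Set Implicit Arguments.
Unset Strict Implicit.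
Unset Printing Implicit Defensive.

(** * Separation of zero from convex weak* compact sets *)

Section WeakStarCompact.
Context {R : realType} {X : normedModType R}.
Implicit Types (A B K : set (X -> R^o)) (a b v w : X -> R^o) (h : X).

Lemma convex_setP A : convex_set A <->
  (forall (t : R) a b, 0 <= t <= 1 -> A a -> A b -> A (t *: a + (1 - t) *: b)).
Proof.
split=> [cA t a b /andP[t0 t1] Aa Ab|cA a b t].
  by have := cA a b (Itv01 t0 t1); rewrite !inE; apply.
rewrite !inE => Aa Ab; apply: (cA t%:num) => //.
by rewrite ge0 le1.
Qed.

Lemma ptws_eval_continuous h : continuous (fun v : {ptws X -> R^o} => v h).
Proof. exact: (@proj_continuous X (fun=> R^o) h). Qed.

Lemma ptws_continuous (T : topologicalType) (F : T -> {ptws X -> R^o}) :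
  (forall h, continuous (fun x => F x h)) -> continuous F.
Proof.
move=> cF x; apply/(@pointwise_cvgP X R^o (F @ x) (F x)) => h.
exact: cF.
Qed.

Lemma dual_sum a (s : seq X) (k : X -> R) : dual a ->
  a (\sum_(h <- s) k h *: h) = \sum_(h <- s) k h * a h.
Proof.
move=> [la _].
have a0 : a 0 = 0 by have := la (-1) 0 0; rewrite !scaleN1r !addNr.
elim: s => [|x s IH]; first by rewrite !big_nil.
by rewrite !big_cons la IH.
Qed.

(** Minimise the sum [G] of the squares of the values on [s].  If [v0] is a
minimiser, then moving from [v0] towards any [v] in [K] cannot decrease [G] to
first order, so that the inner product of the values of [v0] and [v] on [s] is
at least [G v0].  The element [v] that is nonnegative at
[- \sum_(h <- s) v0 h *: h] makes this inner product nonpositive, so that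
[G v0 = 0]. *)
Lemma convex_compact_common_zero K (s : seq X) :
  convex_weak_star_compact K -> (forall h, exists2 v, K v & 0 <= v h) ->
  exists2 v, K v & forall h, h \in s -> v h = 0.
Proof.
move=> [dK K0 /convex_setP cK cptK] sup0.
pose G (v : {ptws X -> R^o}) : R := \sum_(h <- s) v h ^+ 2.
have cG : continuous G.
  move=> v; apply: (@cvg_big R X +%R 0 predT (@add_continuous R) _ (nbhs v) s
    (fun h w => w h ^+ 2) (fun h => v h ^+ 2)) => h _.
  have ev : (fun w : {ptws X -> R^o} => w h) @ nbhs v --> (v h : R).
    exact: ptws_eval_continuous.
  exact: (cvgM ev ev).
have [v0] :=
  @compact_EVT_min {ptws X -> R^o} R G K K0 cptK (continuous_subspaceT cG).
rewrite inE => Kv0 minv0.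
exists v0 => //.
have [v Kv] := sup0 (- \sum_(h <- s) v0 h *: h).
rewrite -sumrN; under eq_bigr do rewrite -scaleNr.
rewrite (@dual_sum _ _ (fun h => - v0 h)); last exact: dK.
set N := G v0; set P := \sum_(h <- s) (v h - v0 h) ^+ 2.
rewrite (eq_bigr (fun h => - (v0 h * v h))) => [|h _]; last by rewrite mulNr.
rewrite sumrN oppr_ge0; set Q := \sum_(h <- s) _ => Q0.
have P0 : 0 <= P by apply: sumr_ge0 => h _; exact: sqr_ge0.
have N0 : 0 <= N by apply: sumr_ge0 => h _; exact: sqr_ge0.
have Gt t : G (t *: v + (1 - t) *: v0) = N + t * (2 * (Q - N)) + t ^+ 2 * P.
  rewrite /N /Q /P /G -sumrB !mulr_sumr -!big_split /=; apply: eq_bigr => h _.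
  by rewrite !fctE /GRing.scale /=; ring.
have [/eqP N_eq0|Nn0] := boolP (N == 0).
  move=> h hs; apply/eqP; rewrite -sqrf_eq0; move: N_eq0 => /eqP.
  rewrite /N /G psumr_eq0 => [|k _]; last exact: sqr_ge0.
  by move=> /allP/(_ _ hs).
have Npos : 0 < N by rewrite lt_neqAle eq_sym Nn0.
have NP : 0 < N + P by rewrite ltr_wpDr.
(* Along the segment, [G] is [N - 2 t (N - Q) + t ^ 2 P]; this step is short
   enough for the linear term to win, and it stays in the unit interval. *)
pose t := N / (N + P).
have t0 : 0 < t by rewrite divr_gt0.
have t1 : t <= 1 by rewrite ler_pdivrMr // mul1r lerDl.
have tP : t * (N + P) = N by rewrite /t divfK // gt_eqF.
have /minv0 : (t *: v + (1 - t) *: v0) \in K.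
  by rewrite inE; apply: cK => //; rewrite ltW.
rewrite Gt -/N => le1.
have le2 : 0 <= t * (2 * (Q - N) + t * P) by nra.
rewrite pmulr_rge0 // in le2.
nra.
Qed.

(** A separation theorem: otherwise a direction would strictly separate [0] from
[K].  Evaluations are continuous on [K], so the sets of zeros of evaluations
form a family of closed sets; [convex_compact_common_zero] gives it the finite
intersection property. *)
Lemma zero_in_convex_compact K :
  convex_weak_star_compact K -> (forall h, exists2 v, K v & 0 <= v h) -> K 0.
Proof.
move=> wK sup0; have [dK _ _ cptK] := wK.
pose F h := K `&` [set v | v h = 0].
have finF : finI [set: X] F.
  move=> D' _.
  have [v Kv v0] := convex_compact_common_zero (finmap.enum_fset D') wK sup0.
  by exists v => h hD; split => //; exact: v0.
have FK : filter_from (finI_from [set: X] F) id K.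
  by exists (F 0); [exact: finI_from1|move=> ? []].
have [v [Kv clv]] := cptK _ (finI_filter finF) FK.
suff -> : 0 = v by [].
apply/funext => h; apply/esym.
have : closed [set v : {ptws X -> R^o} | v h = 0].
  apply: (@preimage_closed _ _ (fun v : {ptws X -> R^o} => v h) [set 0]).
    by move=> ? _; exact: ptws_eval_continuous.
  exact: closed_eq.
apply => B nB; apply: clv => //.
by exists (F h); [exact: finI_from1|move=> ? []].
Qed.

End WeakStarCompact.

(** * Operations that preserve convex weak* compactness *)

Section Closure.
Context {R : realType} {X : normedModType R}.
Implicit Types (A B K : set (X -> R^o)) (a b v w : X -> R^o) (h : X).

Lemma eval_comp_continuous (T : topologicalType) (F : T -> {ptws X -> R^o}) h :
  continuous F -> continuous (fun x => F x h : R).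
Proof.
move=> cF x.
exact: (@continuous_comp _ _ _ F (fun v : {ptws X -> R^o} => v h) x (cF x)
  (@ptws_eval_continuous _ _ h (F x))).
Qed.

Lemma fst_continuous (T U : topologicalType) : continuous (@fst T U).
Proof. by move=> p; exact: cvg_fst. Qed.

Lemma snd_continuous (T U : topologicalType) : continuous (@snd T U).
Proof. by move=> p; exact: cvg_snd. Qed.

Lemma continuousT_comp (S T U : topologicalType) (f : S -> T) (k : T -> U) :
  continuous f -> continuous k -> continuous (k \o f).
Proof. by move=> cf ck x; apply: continuous_comp; [exact: cf|exact: ck]. Qed.

Lemma dualD a b : dual a -> dual b -> dual (a + b).
Proof.
move=> [la ca] [lb cb]; split.
  by move=> t x y; rewrite !fctE la lb scalerDr addrACA.
by move=> x; apply: (@cvgD R R^o); [exact: ca|exact: cb].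
Qed.

Lemma dualZ (t : R) a : dual a -> dual (t *: a).
Proof.
move=> [la ca]; split.
  by move=> s x y; rewrite !fctE la scalerDr !scalerA [t * s]mulrC.
by move=> x; apply: (@cvgM R); [exact: cvg_cst|exact: ca].
Qed.

Lemma dual0 : dual (0 : X -> R^o).
Proof.
split; first by move=> t x y; rewrite /= addr0 scaler0.
by move=> x; exact: cvg_cst.
Qed.

Lemma convex_compact1 w : dual w -> convex_weak_star_compact [set w].
Proof.
move=> dw; split; first by move=> _ ->.
- by exists w.
- apply/convex_setP => t a b _ /= -> ->.
  by rewrite -scalerDl [t + _]addrC subrK scale1r.
- exact: compact_set1.
Qed.

Lemma convex_compactD A B : convex_weak_star_compact A ->
  convex_weak_star_compact B -> convex_weak_star_compact (A `+s` B).
Proof.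
move=> [dA [a0 Aa0] /convex_setP cA kA] [dB [b0 Bb0] /convex_setP cB kB]; split.
- by move=> _ [a Aa] [b Bb] <-; apply: dualD; [exact: dA|exact: dB].
- by exists (a0 + b0), a0 => //; exists b0.
- apply/convex_setP => t _ _ t01 [a1 Aa1] [b1 Bb1 <-] [a2 Aa2] [b2 Bb2 <-].
  exists (t *: a1 + (1 - t) *: a2); first exact: cA.
  exists (t *: b1 + (1 - t) *: b2); first exact: cB.
  by rewrite !scalerDr addrACA.
- pose F (p : {ptws X -> R^o} * {ptws X -> R^o}) : {ptws X -> R^o} :=
    (p.1 : X -> R^o) + (p.2 : X -> R^o).
  have -> : A `+s` B = F @` (A `*` B).
    apply/seteqP; split=> [_ [a Aa [b Bb <-]]|_ [[a b] [/= Aa Bb] <-]].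
      by exists (a, b).
    by exists a => //; exists b.
  apply: (@continuous_compact _ {ptws X -> R^o} F); last exact: compact_setX.
  apply: continuous_subspaceT; apply: ptws_continuous => h p.
  exact: (cvgD (eval_comp_continuous (@fst_continuous _ _) (h := h) (x := p))
               (eval_comp_continuous (@snd_continuous _ _) (h := h) (x := p))).
Qed.

Lemma convex_compact_msum n (F : 'I_n -> set (X -> R^o)) :
  (forall i, convex_weak_star_compact (F i)) ->
  convex_weak_star_compact (\msum_(i < n) F i).
Proof.
elim: n F => [|n IH] F kF.
  by rewrite big_ord0; apply: convex_compact1; exact: dual0.
by rewrite big_ord_recl; apply: convex_compactD => //; apply: IH.
Qed.

Lemma msumP (V : zmodType) n (F : 'I_n -> set V) (p : V) :
  (\msum_(i < n) F i) p <->
  exists2 q : 'I_n -> V, (forall i, F i (q i)) & p = \sum_(i < n) q i.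
Proof.
elim: n F p => [|n IH] F p.
  rewrite big_ord0; split=> [->|[q _ ->]]; last by rewrite big_ord0.
  by exists (fun=> 0); [case|rewrite big_ord0].
rewrite big_ord_recl; split=> [[a Fa [_ /IH[q Fq ->] <-]]|[q Fq ->]].
  exists (fun i => oapp q a (unlift ord0 i)) => [i|].
    by case: unliftP => [j ->|->] /=; [exact: Fq|].
  rewrite big_ord_recl unlift_none /=; congr (_ + _).
  by apply: eq_bigr => i _; rewrite liftK.
exists (q ord0); first exact: Fq.
rewrite big_ord_recl; exists (\sum_(i < n) q (lift ord0 i)) => //.
by apply/IH; exists (fun i => q (lift ord0 i)).
Qed.

(** For nonempty convex [A] and [B], this is [c] times the convex hull of [0], [A]
and [-B].  The weights are explicit because they are the multipliers of one
equality constraint: [st.1] is [mu_up] and [st.2] is [mu_lo]. *)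
Definition signed_hull (c : R) A B : set (X -> R^o) :=
  [set p | exists st : R * R, exists ab : (X -> R^o) * (X -> R^o),
    [/\ [/\ 0 <= st.1, 0 <= st.2 & st.1 + st.2 <= c], A ab.1, B ab.2 &
        p = st.1 *: ab.1 - st.2 *: ab.2]].

(** Homogeneity in the weights is what makes the set of all [s *: a], with [s] in
a convex set of nonnegative weights, convex. *)
Lemma convex_set_merge A (s t : R) a b : convex_set A -> 0 <= s -> 0 <= t ->
  A a -> A b -> exists2 e, A e & s *: a + t *: b = (s + t) *: e.
Proof.
move=> /convex_setP cA s0 t0 Aa Ab; have [st0|st0] := eqVneq (s + t) 0.
  exists a => //; have [-> ->] : s = 0 /\ t = 0 by split; lra.
  by rewrite !scale0r !addr0 scale0r.
have st : 0 < s + t by rewrite lt_neqAle eq_sym st0 addr_ge0.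
have q : 1 - s / (s + t) = t / (s + t) by field.
exists (s / (s + t) *: a + (1 - s / (s + t)) *: b).
  apply: cA => //; apply/andP; split; first by rewrite divr_ge0 // ltW.
  by rewrite ler_pdivrMr // mul1r lerDl.
by rewrite q scalerDr !scalerA !(mulrC (s + t)) !divfK.
Qed.

(** The hull is the continuous image of [T `*` (A `*` B)], with [T] the triangle
of admissible weights. *)
Lemma convex_compact_signed_hull c A B : 0 <= c ->
  convex_weak_star_compact A -> convex_weak_star_compact B ->
  convex_weak_star_compact (signed_hull c A B).
Proof.
move=> c0 [dA [a0 Aa0] cA kA] [dB [b0 Bb0] cB kB]; split.
- move=> _ [[s t]] [[a b]] [_ /dA da /dB db ->].
  by rewrite -scaleNr; apply: dualD; exact: dualZ.
- by exists (0 *: a0 - 0 *: b0), (0, 0), (a0, b0); split=> //=; split=> //; lra.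
- apply/convex_setP => r p1 p2 /andP[r0 r1].
  move=> [[s1 t1]] [[a1 b1]] [/= [s10 t10 st1] Aa1 Bb1 ->].
  move=> [[s2 t2]] [[a2 b2]] [/= [s20 t20 st2] Aa2 Bb2 ->].
  have q0 : 0 <= 1 - r by lra.
  have [a Aa ea] := convex_set_merge cA (mulr_ge0 r0 s10) (mulr_ge0 q0 s20) Aa1 Aa2.
  have [b Bb eb] := convex_set_merge cB (mulr_ge0 r0 t10) (mulr_ge0 q0 t20) Bb1 Bb2.
  exists (r * s1 + (1 - r) * s2, r * t1 + (1 - r) * t2), (a, b).
  split=> //=.
    by split; [apply: addr_ge0; exact: mulr_ge0|
               apply: addr_ge0; exact: mulr_ge0|nra].
  by rewrite -ea -eb !scalerBr !scalerA opprD addrACA.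
- pose W : topologicalType := {ptws X -> R^o}.
  pose F (p : (R^o * R^o) * (W * W)) : {ptws X -> R^o} :=
    p.1.1 *: (p.2.1 : X -> R^o) - p.1.2 *: (p.2.2 : X -> R^o).
  pose T : set (R^o * R^o) := (`[0, c] `*` `[0, c]) `&`
    [set st | st.1 + st.2 <= c].
  have -> : signed_hull c A B = F @` (T `*` (A `*` B)).
    apply/seteqP; split.
      move=> _ [[s t]] [[a b]] [/= [s0 t0 st] Aa Bb ->].
      exists ((s, t), (a, b)) => //; split => //; split => //=.
      by rewrite /= !in_itv /= s0 t0 /=; split; lra.
    move=> _ [[[s t] [a b]] [/= [[/= + +] st] [Aa Bb]] <-].
    rewrite !in_itv /= => /andP[s0 _] /andP[t0 _].
    by exists (s, t), (a, b).
  apply: (@continuous_compact _ {ptws X -> R^o} F); last first.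
    apply: compact_setX; last exact: compact_setX.
    have kT : compact (`[0 : R^o, c] `*` `[0 : R^o, c]).
      by apply: compact_setX; exact: segment_compact.
    apply: compact_closedI => //.
    apply: (@preimage_closed _ _ (fun st : R^o * R^o => st.1 + st.2) [set x | x <= c]).
      by move=> ? _; exact: add_continuous.
    exact: closed_le.
  apply: continuous_subspaceT; apply: ptws_continuous => h p.
  have e11 := continuousT_comp (@fst_continuous (R^o * R^o)%type (W * W)%type)
                               (@fst_continuous R^o R^o).
  have e12 := continuousT_comp (@fst_continuous (R^o * R^o)%type (W * W)%type)
                               (@snd_continuous R^o R^o).
  have e21 := continuousT_comp (@snd_continuous (R^o * R^o)%type (W * W)%type)
                               (@fst_continuous W W).
  have e22 := continuousT_comp (@snd_continuous (R^o * R^o)%type (W * W)%type)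
                               (@snd_continuous W W).
  exact: (cvgB (cvgM (e11 p) (eval_comp_continuous e21 (h := h) (x := p)))
               (cvgM (e12 p) (eval_comp_continuous e22 (h := h) (x := p)))).
Qed.

End Closure.

(** * Directional derivatives of the penalty function *)

Section DirectionalDerivative.
Context {R : realType} {X : normedModType R}.
Implicit Types (p q : X -> R) (x h : X) (d e : R).

Lemma has_dir_derivative_unique p x h d e :
  has_dir_derivative p x h d -> has_dir_derivative p x h e -> d = e.
Proof. by move=> pd pe; exact: (cvg_unique _ pd pe). Qed.

Lemma has_dir_derivativeD p q x h d e :
  has_dir_derivative p x h d -> has_dir_derivative q x h e ->
  has_dir_derivative (fun y => p y + q y) x h (d + e).
Proof.
move=> pd qe; rewrite /has_dir_derivative.
under eq_cvg do rewrite opprD addrACA mulrDl.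
exact: (cvgD pd qe).
Qed.

Lemma has_dir_derivativeZ (c : R) p x h d : has_dir_derivative p x h d ->
  has_dir_derivative (fun y => c * p y) x h (c * d).
Proof.
move=> pd; rewrite /has_dir_derivative.
under eq_cvg do rewrite -mulrBr -mulrA.
exact: (cvgM (cvg_cst c) pd).
Qed.

Lemma has_dir_derivative_sum n (p : 'I_n -> X -> R) x h (d : 'I_n -> R) :
  (forall i, has_dir_derivative (p i) x h (d i)) ->
  has_dir_derivative (fun y => \sum_(i < n) p i y) x h (\sum_(i < n) d i).
Proof.
move=> pd; rewrite /has_dir_derivative.
under eq_cvg do rewrite -sumrB mulr_suml.
by apply: (cvg_big (@add_continuous R)) => i _; exact: pd.
Qed.

(** The step [a] is positive, so it can be moved inside the absolute value. *)
Lemma has_dir_derivative_abs p x h d : p x = 0 -> has_dir_derivative p x h d ->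
  has_dir_derivative (fun y => `|p y|) x h `|d|.
Proof.
move=> px0 /cvg_norm pd; apply: (cvg_trans _ pd).
apply: near_eq_cvg; near=> a.
have a0 : 0 < a by near: a; exact: nbhs_right_gt.
by rewrite px0 normr0 !subr0 normrM normfV (gtr0_norm a0).
Unshelve. all: by end_near. Qed.

(** At an active constraint the positive part reduces to the absolute value.  At
an inactive one, differentiability along the half-line implies continuity along
it, so that the constraint stays inactive for small steps. *)
Lemma has_dir_derivative_max0 p x h d : p x <= 0 -> has_dir_derivative p x h d ->
  has_dir_derivative (fun y => Num.max (p y) 0) x h
    (if p x == 0 then Num.max d 0 else 0).
Proof.
move=> px0 pd; have [px|pxn] := eqVneq (p x) 0.
  have maxE (r : R) : Num.max r 0 = 2^-1 * (r + `|r|).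
    have [r0|r0] := leP r 0; first by rewrite ler0_norm // subrr mulr0.
    by rewrite gtr0_norm //; field.
  have -> : (fun y => Num.max (p y) 0) = (fun y => 2^-1 * (p y + `|p y|)).
    by apply/funext => y; exact: maxE.
  rewrite maxE; apply: has_dir_derivativeZ; apply: has_dir_derivativeD => //.
  exact: has_dir_derivative_abs.
have {pxn}px_lt : p x < 0 by rewrite lt_neqAle pxn.
have id0 : a @[a --> (0 : R)^'+] --> (0 : R) by exact/cvg_at_right_filter/cvg_id.
have px_cvg : p (x + a *: h) @[a --> (0 : R)^'+] --> p x.
  have : a * ((p (x + a *: h) - p x) / a) + p x @[a --> (0 : R)^'+] --> 0 * d + p x.
    by apply: cvgD; [exact: cvgM|exact: cvg_cst].
  rewrite mul0r add0r => e; apply: (cvg_trans _ e); apply: near_eq_cvg; near=> a.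
  have a0 : 0 < a by near: a; exact: nbhs_right_gt.
  by rewrite /= mulrC divfK ?gt_eqF // subrK.
have cst0 : (fun=> 0 : R) a @[a --> (0 : R)^'+] --> (0 : R) by exact: cvg_cst.
apply: (cvg_trans _ cst0); apply: near_eq_cvg; near=> a.
have pa : p (x + a *: h) < 0 by near: a; exact: (cvgr_lt _ px_cvg).
by rewrite /= (max_r (ltW pa)) (max_r (ltW px_lt)) subrr mul0r.
Unshelve. all: by end_near. Qed.

Lemma has_dir_derivative_Psi l m (u : X -> R) (f : 'I_l -> X -> R)
    (g : 'I_m -> X -> R) (c : R) x h (du : R) (df : 'I_l -> R) (dg : 'I_m -> R) :
  feasible f g x -> has_dir_derivative u x h du ->
  (forall j, has_dir_derivative (f j) x h (df j)) ->
  (forall i, has_dir_derivative (g i) x h (dg i)) ->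
  has_dir_derivative (Psi u f g c) x h
    (du + c * (\sum_(j < l) `|df j| +
               \sum_(i < m) if g i x == 0 then Num.max (dg i) 0 else 0)).
Proof.
move=> [fx gx] Du Df Dg; apply: has_dir_derivativeD => //.
apply: has_dir_derivativeZ; apply: has_dir_derivativeD.
  by apply: has_dir_derivative_sum => j; exact: has_dir_derivative_abs.
by apply: has_dir_derivative_sum => i; exact: has_dir_derivative_max0.
Qed.

(** The common meaning of the two optimality conditions.  No quasidifferential
occurs in it, which is why neither condition depends on their choice. *)
Definition dir_stationary p x :=
  forall h d, has_dir_derivative p x h d -> 0 <= d.

End DirectionalDerivative.

(** * Bounds on support functions *)

Section Support.
Context {R : realType} {X : normedModType R}.
Implicit Types (A B S : set (X -> R^o)) (v w : X -> R^o) (h : X) (c d e : R).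

Definition support_le S h d := forall v, S v -> v h <= d.

(** On a nonempty weak* compact set, where the supremum is attained, this says
that the support function at [h] is at least [d]. *)
Definition support_ge S h d := exists2 v, S v & d <= v h.

Lemma support_leD A B h d e :
  support_le A h d -> support_le B h e -> support_le (A `+s` B) h (d + e).
Proof. by move=> Ad Be _ [v Av] [w Bw] <-; apply: lerD; [exact: Ad|exact: Be]. Qed.

Lemma support_geD A B h d e :
  support_ge A h d -> support_ge B h e -> support_ge (A `+s` B) h (d + e).
Proof.
move=> [v Av dv] [w Bw ew]; exists (v + w); last exact: lerD.
by exists v => //; exists w.
Qed.

Lemma support_le1 w h : support_le [set w] h (w h).
Proof. by move=> _ ->. Qed.

Lemma support_le_msum n (F : 'I_n -> set (X -> R^o)) h (d : 'I_n -> R) :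
  (forall i, support_le (F i) h (d i)) ->
  support_le (\msum_(i < n) F i) h (\sum_(i < n) d i).
Proof.
elim: n F d => [|n IH] F d Fd; first by rewrite !big_ord0 => _ ->.
by rewrite !big_ord_recl; apply: support_leD; [exact: Fd|exact: IH].
Qed.

Lemma support_ge_msum n (F : 'I_n -> set (X -> R^o)) h (d : 'I_n -> R) :
  (forall i, support_ge (F i) h (d i)) ->
  support_ge (\msum_(i < n) F i) h (\sum_(i < n) d i).
Proof.
elim: n F d => [|n IH] F d Fd; first by rewrite !big_ord0; exists 0.
by rewrite !big_ord_recl; apply: support_geD; [exact: Fd|exact: IH].
Qed.

Lemma support_le_signed_hull c A B h d : 0 <= d ->
  (forall v, A v -> v h <= d) -> (forall v, B v -> - v h <= d) ->
  support_le (signed_hull c A B) h (c * d).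
Proof.
move=> d0 Ad Bd _ [[s t]] [[v w]] [/= [s0 t0 st] /Ad vd /Bd wd ->].
rewrite !fctE /GRing.scale /=; nra.
Qed.

Lemma support_ge_signed_hull c A B h d : 0 <= c -> B !=set0 ->
  support_ge A h d -> support_ge (signed_hull c A B) h (c * d).
Proof.
move=> c0 [w Bw] [v Av dv]; exists (c *: v - 0 *: w); last first.
  by rewrite !fctE /GRing.scale /= mul0r subr0 ler_wpM2l.
by exists (c, 0), (v, w); split => //=; split => //; rewrite addr0.
Qed.

Lemma support_ge_signed_hullN c A B h d : 0 <= c -> A !=set0 ->
  (exists2 w, B w & d <= - w h) -> support_ge (signed_hull c A B) h (c * d).
Proof.
move=> c0 [v Av] [w Bw dw]; exists (0 *: v - c *: w); last first.
  by rewrite !fctE /GRing.scale /= mul0r sub0r -mulrN ler_wpM2l.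
by exists (0, c), (v, w); split => //=; split => //; rewrite add0r.
Qed.

End Support.

(** * Quasidifferentials and condition (A) *)

Section Quasi.
Context {R : realType} {X : normedModType R}.
Implicit Types (p : X -> R) (x h : X) (D : set (X -> R^o) * set (X -> R^o)).

(** Attaining pairs are used in place of the extreme values because they are the
selections to which the two conditions have to be applied. *)
Record active D h (d : R) (v w : X -> R^o) : Prop := Active {
  active_sub : D.1 v;
  active_super : D.2 w;
  active_max : forall v', D.1 v' -> v' h <= v h;
  active_min : forall w', D.2 w' -> w h <= w' h;
  active_val : d = v h + w h }.

Lemma quasidifferential_active p x D h : is_quasidifferential p x D ->
  exists d : R, exists v w,
    has_dir_derivative p x h d /\ active D h d v w.
Proof.
move=> [_ _ /(_ h)[M [n [[[v Dv <-] vmax] [[w Dw <-] wmin] der]]]].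
exists (v h + w h), v, w; split => //; split => //.
  by move=> v' Dv'; apply: vmax; exists v'.
by move=> w' Dw'; apply: wmin; exists w'.
Qed.

Lemma quasidifferential_active_fam n (p : 'I_n -> X -> R) x
    (D : 'I_n -> set (X -> R^o) * set (X -> R^o)) h :
  (forall i, is_quasidifferential (p i) x (D i)) ->
  exists (d : 'I_n -> R) (v w : 'I_n -> X -> R^o), forall i,
    has_dir_derivative (p i) x h (d i) /\ active (D i) h (d i) (v i) (w i).
Proof.
move=> qd.
have /choice [k kP] : forall i, exists k : R * ((X -> R^o) * (X -> R^o)),
    has_dir_derivative (p i) x h k.1 /\ active (D i) h k.1 k.2.1 k.2.2.
  move=> i; have [d [v [w dvw]]] := quasidifferential_active h (qd i).
  by exists (d, (v, w)).
by exists (fun i => (k i).1), (fun i => (k i).2.1), (fun i => (k i).2.2).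
Qed.

(** If (A) holds, apply it to a [w] that attains the minimum at [h]: then
[D.1 + w] contains [0], so that the maximum over it, which is the derivative, is
nonnegative.  Conversely, for any [w] the support function of [D.1 + w]
dominates the derivative. *)
Lemma conditionAP p x D : is_quasidifferential p x D ->
  conditionA D <-> dir_stationary p x.
Proof.
move=> qd; have [kD1 [dD2 _ _ _] _] := qd; split=> [cA h d pd|st w Dw].
  have [e [v [w [pe vw]]]] := quasidifferential_active h qd.
  rewrite (has_dir_derivative_unique pd pe) (active_val vw).
  have [v' Dv' [_ ->] vw0] := cA _ (active_super vw).
  have <- : v' h + w h = 0 by exact: (congr1 (@^~ h) vw0).
  by rewrite lerD2r; exact: (active_max vw).
apply: zero_in_convex_compact => [|h].
  by apply: convex_compactD => //; apply: convex_compact1; exact: dD2.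
have [d [v0 [w0 [/st d0 vw]]]] := quasidifferential_active h qd.
exists (v0 + w); first by exists v0; [exact: active_sub vw|exists w].
rewrite (le_trans d0) // (active_val vw) !fctE lerD2l.
exact: (active_min vw).
Qed.

End Quasi.

(** * Multipliers and condition (B) *)

Section Multipliers.
Context {R : realType} {X : normedModType R} {l m : nat}.
Variables (u : X -> R) (f : 'I_l -> X -> R) (g : 'I_m -> X -> R) (x : X) (c : R).
Variables (Du : set (X -> R^o) * set (X -> R^o)).
Variables (Df : 'I_l -> set (X -> R^o) * set (X -> R^o)).
Variables (Dg : 'I_m -> set (X -> R^o) * set (X -> R^o)).
Implicit Types (v w : 'I_l -> X -> R^o) (z : 'I_m -> X -> R^o).

(** This bound on the multiplier of an inequality constraint replaces both the
bound by [c] and complementary slackness. *)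
Definition active_penalty (i : 'I_m) : R := if g i x == 0 then c else 0.

(** The inequality constraints have no negative part, hence the set [[set 0]] in
the second place of their hulls. *)
Definition multiplier_set (w0 : X -> R^o) v w z : set (X -> R^o) :=
  Du.1 `+s` [set w0]
  `+s` \msum_(j < l)
    (signed_hull c ((Df j).1 `+s` [set w j]) ([set v j] `+s` (Df j).2))
  `+s` \msum_(i < m)
    (signed_hull (active_penalty i) ((Dg i).1 `+s` [set z i]) [set 0]).

(** The two sides regroup the same sum: on the left the multipliers are chosen
first and the summands are grouped by kind, on the right each constraint has its
own summand. *)
Lemma multipliersP (w0 : X -> R^o) v w z : 0 <= c ->
  (exists (mu_lo mu_up : 'I_l -> R) (lam : 'I_m -> R),
    [/\ (forall j, 0 <= mu_lo j /\ 0 <= mu_up j), (forall i, 0 <= lam i),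
        (Du.1 `+s` [set w0]
         `+s` (-1) `*:` (\msum_(j < l) (mu_lo j `*:` ([set v j] `+s` (Df j).2)))
         `+s` (\msum_(j < l) (mu_up j `*:` ((Df j).1 `+s` [set w j])))
         `+s` (\msum_(i < m) (lam i `*:` ((Dg i).1 `+s` [set z i])))) 0,
        (forall i, lam i * g i x = 0) &
        (forall j, mu_lo j + mu_up j <= c) /\ (forall i, lam i <= c)]) <->
  multiplier_set w0 v w z 0.
Proof.
move=> c0; split.
  move=> [lo [up [lam [mu0 lam0 + lamg [muc lamc]]]]].
  move=> [_ [_ [a Ua [_ [_ /msumP[b Fb ->] <-]] <-] [_ /msumP[e Fe ->] <-]]].
  move=> [_ /msumP[k Fk ->] E].
  have /choice[b' Fb'] j : exists b', ([set v j] `+s` (Df j).2) b' /\ lo j *: b' = b j.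
    by have [b'] := Fb j; exists b'.
  have /choice[e' Fe'] j : exists e', ((Df j).1 `+s` [set w j]) e' /\ up j *: e' = e j.
    by have [e'] := Fe j; exists e'.
  have /choice[k' Fk'] i : exists k', ((Dg i).1 `+s` [set z i]) k' /\ lam i *: k' = k i.
    by have [k'] := Fk i; exists k'.
  exists (a + \sum_(j < l) (up j *: e' j - lo j *: b' j)).
    exists a => //; exists (\sum_(j < l) (up j *: e' j - lo j *: b' j)) => //.
    apply/msumP; eexists; last by [].
    move=> j; exists (up j, lo j), (e' j, b' j).
    have [/= Fbj _] := Fb' j; have [/= Fej _] := Fe' j; have [lo0 up0] := mu0 j.
    by split => //=; split => //; rewrite addrC.
  exists (\sum_(i < m) (lam i *: k' i - 0 *: 0)).
    apply/msumP; eexists; last by [].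
    move=> i; exists (lam i, 0), (k' i, 0); have [/= Fki _] := Fk' i.
    split => //=; split => //; rewrite addr0 /active_penalty.
    case: eqVneq => // gi; have /eqP := lamg i.
    by rewrite mulf_eq0 (negbTE gi) orbF => /eqP ->.
  rewrite -[RHS]E sumrB scaleN1r; congr (_ + _).
    rewrite [RHS]addrAC -[RHS]addrA; congr (_ + (_ - _)).
      by apply: eq_bigr => j _; have [] := Fe' j.
    by apply: eq_bigr => j _; have [] := Fb' j.
  by apply: eq_bigr => i _; rewrite scaler0 subr0; have [] := Fk' i.
move=> [_ [a Ua [_ /msumP[q Fq ->] <-]] [_ /msumP[k Fk ->] E]].
have /choice [st Fst] := Fq; have /choice [eb Feb] := Fst.
have /choice [s Fs] := Fk; have /choice [k' Fk'] := Fs.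
exists (fun j => (st j).2), (fun j => (st j).1), (fun i => (s i).1).
split.
- by move=> j; have [[? ?]] := Feb j.
- by move=> i; have [[? ?]] := Fk' i.
- exists (a + (-1) *: (\sum_(j < l) (st j).2 *: (eb j).2)
            + \sum_(j < l) (st j).1 *: (eb j).1).
    exists (a + (-1) *: (\sum_(j < l) (st j).2 *: (eb j).2)).
      exists a => //; eexists; last by [].
      eexists; last by [].
      apply/msumP; eexists; last by [].
      by move=> j; have [_ _ ? _] := Feb j; exists (eb j).2.
    eexists; last by [].
    apply/msumP; eexists; last by [].
    by move=> j; have [_ ? _ _] := Feb j; exists (eb j).1.
  exists (\sum_(i < m) (s i).1 *: (k' i).1).
    apply/msumP; eexists; last by [].
    by move=> i; have [_ ? _ _] := Fk' i; exists (k' i).1.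
  rewrite -[RHS]E -[in RHS]addrA scaleN1r -!addrA; congr (_ + _).
  rewrite addrA; congr (_ + _).
    rewrite addrC -sumrB; apply: eq_bigr => j _.
    by have [_ _ _ ->] := Feb j.
  apply: eq_bigr => i _; have [_ _ -> ->] := Fk' i.
  by rewrite scaler0 subr0.
- move=> i; have [[s0 t0 +] _ _ _] := Fk' i; rewrite /active_penalty.
  have [->|_ st0] := eqVneq; first by rewrite mulr0.
  by have -> : (s i).1 = 0; [lra|rewrite mul0r].
- split=> [j|i]; first by have [[_ _ ?] _ _ _] := Feb j; rewrite addrC.
  have [[s0 t0 +] _ _ _] := Fk' i; rewrite /active_penalty.
  by case: ifP => _; lra.
Qed.

Hypotheses (feas : feasible f g x) (c0 : 0 <= c).
Hypothesis qu : is_quasidifferential u x Du.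
Hypothesis qf : forall j, is_quasidifferential (f j) x (Df j).
Hypothesis qg : forall i, is_quasidifferential (g i) x (Dg i).

Lemma active_penalty_ge0 i : 0 <= active_penalty i.
Proof. by rewrite /active_penalty; case: ifP. Qed.

Lemma convex_compact_multiplier_set (w0 : X -> R^o) v w z :
  Du.2 w0 -> (forall j, (Df j).1 (v j)) -> (forall j, (Df j).2 (w j)) ->
  (forall i, (Dg i).2 (z i)) ->
  convex_weak_star_compact (multiplier_set w0 v w z).
Proof.
move=> Dw0 Dv Dw Dz.
have [kU1 [dU2 _ _ _] _] := qu.
apply: convex_compactD; first apply: convex_compactD.
- by apply: convex_compactD => //; apply: convex_compact1; exact: dU2.
- apply: convex_compact_msum => j; have [k1 k2 _] := qf j.
  have [d1 _ _ _] := k1; have [d2 _ _ _] := k2.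
  apply: convex_compact_signed_hull => //; apply: convex_compactD => //.
    by apply: convex_compact1; exact: d2.
  by apply: convex_compact1; exact: d1.
- apply: convex_compact_msum => i; have [k1 [d2 _ _ _] _] := qg i.
  apply: convex_compact_signed_hull; first exact: active_penalty_ge0.
    by apply: convex_compactD => //; apply: convex_compact1; exact: d2.
  by apply: convex_compact1; exact: dual0.
Qed.

Definition Psi_slope (du : R) (df : 'I_l -> R) (dg : 'I_m -> R) : R :=
  du + \sum_(j < l) c * `|df j| + \sum_(i < m) active_penalty i * Num.max (dg i) 0.

Lemma has_dir_derivative_Psi_slope h (du : R) (df : 'I_l -> R) (dg : 'I_m -> R) :
  has_dir_derivative u x h du ->
  (forall j, has_dir_derivative (f j) x h (df j)) ->
  (forall i, has_dir_derivative (g i) x h (dg i)) ->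
  has_dir_derivative (Psi u f g c) x h (Psi_slope du df dg).
Proof.
move=> hu hf hg; have := has_dir_derivative_Psi (c := c) feas hu hf hg.
congr has_dir_derivative; rewrite /Psi_slope mulrDr !mulr_sumr addrA.
congr (_ + _); apply: eq_bigr => i _.
by rewrite /active_penalty; case: ifP => _; rewrite ?mulr0 ?mul0r.
Qed.

Section SupportMultiplierSet.
Variables (h : X) (du : R) (df : 'I_l -> R) (dg : 'I_m -> R).
Variables (vu wu : X -> R^o) (vf wf : 'I_l -> X -> R^o) (vg wg : 'I_m -> X -> R^o).
Hypothesis au : active Du h du vu wu.
Hypothesis af : forall j, active (Df j) h (df j) (vf j) (wf j).
Hypothesis ag : forall i, active (Dg i) h (dg i) (vg i) (wg i).

(** With the selections that attain the extrema at [h], the values at [h] of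
[Df.1 + wf] and of [-(vf + Df.2)] are at most [df] and [- df]. *)
Lemma support_le_multiplier_set :
  support_le (multiplier_set wu vf wf wg) h (Psi_slope du df dg).
Proof.
apply: support_leD; first apply: support_leD.
- rewrite (active_val au); apply: support_leD; last exact: support_le1.
  exact: (active_max au).
- apply: support_le_msum => j; have aj := af j.
  apply: support_le_signed_hull => //.
    move=> _ [v' Dv' [_ -> <-]]; rewrite (le_trans _ (ler_norm _)) //.
    by rewrite (active_val aj) lerD2r; exact: (active_max aj).
  move=> _ [_ -> [w' Dw' <-]]; rewrite -normrN (le_trans _ (ler_norm _)) //.
  by rewrite (active_val aj) lerN2 lerD2l; exact: (active_min aj).
- apply: support_le_msum => i; have ai := ag i.
  apply: support_le_signed_hull.
  + by rewrite le_max lexx orbT.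
  + move=> _ [v' Dv' [_ -> <-]]; rewrite le_max; apply/orP; left.
    by rewrite (active_val ai) lerD2r; exact: (active_max ai).
  + by move=> _ ->; rewrite oppr0 le_max lexx orbT.
Qed.

(** Only one selection in each pair is prescribed; the other one can be taken to
attain its extremum at [h].  The sign of the derivative of a constraint tells
which side of its hull to use. *)
Lemma support_ge_multiplier_set (w0 : X -> R^o) v w z :
  Du.2 w0 -> (forall j, (Df j).1 (v j)) -> (forall j, (Df j).2 (w j)) ->
  (forall i, (Dg i).2 (z i)) ->
  support_ge (multiplier_set w0 v w z) h (Psi_slope du df dg).
Proof.
move=> Dw0 Dv Dw Dz; apply: support_geD; first apply: support_geD.
- exists (vu + w0).
    by exists vu; [exact: active_sub au|exists w0].
  by rewrite (active_val au) lerD2l; exact: (active_min au).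
- apply: support_ge_msum => j; have aj := af j.
  have [vj wj] := (active_sub aj, active_super aj).
  have [df0|df0] := leP 0 (df j).
    apply: support_ge_signed_hull => //.
      by exists (v j + w j), (v j) => //; exists (w j).
    exists (vf j + w j); first by exists (vf j) => //; exists (w j).
    by rewrite ger0_norm // (active_val aj) lerD2l; exact: (active_min aj).
  apply: support_ge_signed_hullN => //.
    by exists (v j + w j), (v j) => //; exists (w j).
  exists (v j + wf j); first by exists (v j) => //; exists (wf j).
  by rewrite ltr0_norm // (active_val aj) lerN2 lerD2r; exact: (active_max aj).
- apply: support_ge_msum => i; have ai := ag i.
  have vi := active_sub ai.
  have [dg0|dg0] := leP (dg i) 0.
    apply: support_ge_signed_hullN; first exact: active_penalty_ge0.
      by exists (vg i + z i), (vg i) => //; exists (z i).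
    by exists 0 => //; rewrite oppr0.
  apply: support_ge_signed_hull; [exact: active_penalty_ge0|by exists 0|].
  exists (vg i + z i); first by exists (vg i) => //; exists (z i).
  by rewrite (active_val ai) lerD2l; exact: (active_min ai).
Qed.

End SupportMultiplierSet.

(** From (B), given [h], choose the selections that attain the extrema at [h]:
the multiplier set contains [0] and its support function at [h] is at most the
derivative.  Conversely, for all selections the support function of the
multiplier set dominates the derivative, so that separation applies. *)
Lemma conditionBP : conditionB g c x Du Df Dg <-> dir_stationary (Psi u f g c) x.
Proof.
have slope h := (quasidifferential_active h qu,
  quasidifferential_active_fam h qf, quasidifferential_active_fam h qg).
split=> [cB h d Pd|st w0 v w z Dw0 Dv Dw Dz].
  have [[[du [vu [wu [ud au]]]] [df [vf [wf af]]]] [dg [vg [wg ag]]]] := slope h.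
  have Pe := has_dir_derivative_Psi_slope ud (fun j => (af j).1) (fun i => (ag i).1).
  rewrite (has_dir_derivative_unique Pd Pe).
  have /(multipliersP _ _ _ _ c0) K0 := cB wu vf wf wg (active_super au)
    (fun j => active_sub (af j).2) (fun j => active_super (af j).2)
    (fun i => active_super (ag i).2).
  exact: (support_le_multiplier_set au (fun j => (af j).2) (fun i => (ag i).2) K0).
apply/multipliersP => //; apply: zero_in_convex_compact => [|h].
  exact: convex_compact_multiplier_set.
have [[[du [vu [wu [ud au]]]] [df [vf [wf af]]]] [dg [vg [wg ag]]]] := slope h.
have Pe := has_dir_derivative_Psi_slope ud (fun j => (af j).1) (fun i => (ag i).1).
have [p Kp dp] := support_ge_multiplier_set au (fun j => (af j).2)
  (fun i => (ag i).2) Dw0 Dv Dw Dz.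
by exists p => //; apply: le_trans dp; exact: st Pe.
Qed.

End Multipliers.

Theorem proposition2 (R : realType) (X : completeNormedModType R) (l m : nat)
    (u : X -> R) (f : 'I_l -> X -> R) (g : 'I_m -> X -> R) (xbar : X) (c : R) :
  feasible f g xbar ->
  quasidifferentiable u xbar ->
  (forall j, quasidifferentiable (f j) xbar) ->
  (forall i, quasidifferentiable (g i) xbar) ->
  0 <= c ->
  [/\ forall (DPsi Du : set (X -> R^o) * set (X -> R^o))
             (Df : 'I_l -> set (X -> R^o) * set (X -> R^o))
             (Dg : 'I_m -> set (X -> R^o) * set (X -> R^o)),
        is_quasidifferential (Psi u f g c) xbar DPsi ->
        is_quasidifferential u xbar Du ->
        (forall j, is_quasidifferential (f j) xbar (Df j)) ->
        (forall i, is_quasidifferential (g i) xbar (Dg i)) ->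
        (conditionA DPsi <-> conditionB g c xbar Du Df Dg),
      forall DPsi DPsi' : set (X -> R^o) * set (X -> R^o),
        is_quasidifferential (Psi u f g c) xbar DPsi ->
        is_quasidifferential (Psi u f g c) xbar DPsi' ->
        conditionA DPsi -> conditionA DPsi'
    & forall (Du Du' : set (X -> R^o) * set (X -> R^o))
             (Df Df' : 'I_l -> set (X -> R^o) * set (X -> R^o))
             (Dg Dg' : 'I_m -> set (X -> R^o) * set (X -> R^o)),
        is_quasidifferential u xbar Du -> is_quasidifferential u xbar Du' ->
        (forall j, is_quasidifferential (f j) xbar (Df j)) ->
        (forall j, is_quasidifferential (f j) xbar (Df' j)) ->
        (forall i, is_quasidifferential (g i) xbar (Dg i)) ->
        (forall i, is_quasidifferential (g i) xbar (Dg' i)) ->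
        conditionB g c xbar Du Df Dg -> conditionB g c xbar Du' Df' Dg'].
Proof.
move=> feas _ _ _ c0; split.
- move=> DPsi Du Df Dg qP qu qf qg.
  exact: iff_trans (conditionAP qP) (iff_sym (conditionBP feas c0 qu qf qg)).
- by move=> D D' qD qD' /(conditionAP qD)/(conditionAP qD').
- move=> Du Du' Df Df' Dg Dg' qu qu' qf qf' qg qg'.
  by move=> /(conditionBP feas c0 qu qf qg)/(conditionBP feas c0 qu' qf' qg').
Qed.
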